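(* Let $f,h:X\to\mathbb{R}\cup\{\infty\}$ satisfy the standing assumptions in the context. Suppose $\gamma>1$ is such that $f$ has $\gamma$-curvature relative to $h$ with constant $C$ and $h^*$ has $\gamma$-curvature relative to $\tilde f^*$ with constant $C^*$ (both defined in the context), where $\tilde f(y)=f(-y)$. Let $(x_k,u_k,s_k,z_k)$, $k=0,1,2,\dots$, be the iterates generated by the primal-dual hybrid algorithm (defined in the context), where $\alpha_0=1$ and for $k=1,2,\dots$ the step size $\alpha_k\in[0,1]$ is chosen by the line search $$\alpha_k\in\operatorname*{argmin}_{\alpha\in[0,1]}\bigl\{(1-\alpha)\,H_k+D_f(x_k+\alpha(s_k-x_k),x_k)+D_{h^*}(-u_k-\alpha(z_k-u_k),-u_k)\bigr\},$$ with $H_1=D_f(s_0,x_0)+D_{h^*}(-z_0,-u_0)$ and, for $k=1,2,\dots$, $$H_{k+1}=(1-\alpha_k)H_k+D_f((1-\alpha_k)x_k+\alpha_ks_k,x_k)+D_{h^*}(-(1-\alpha_k)u_k-\alpha_kz_k,-u_k).$$ Then for all $k=1,2,\dots$ $$f(x_k)+h(x_k)+f^*(u_k)+h^*(-u_k)\le(C+C^* )\left(\frac{\gamma}{k+\gamma}\right)^{\gamma-1}.$$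
   Context: Setting. $X$ is a finite-dimensional real vector space with dual $X^*$ and pairing $\langle\cdot,\cdot\rangle$. $f,h:X\to\mathbb{R}\cup\{\infty\}$ are proper closed convex functions with Fenchel conjugates $f^*,h^*:X^*\to\mathbb{R}\cup\{\infty\}$. $\operatorname{dom}(\partial f)\subseteq X$ and $\operatorname{dom}(\partial h^* )\subseteq X^*$ are the sets of points at which the respective subdifferential is nonempty. Single-valued oracles are fixed: for each $y\in\operatorname{dom}(\partial f)$, $\partial f(y)\in X^*$ denotes one fixed chosen element of $\operatorname{argmax}_{v\in X^*}\{\langle v,y\rangle-f^*(v)\}$ (the subdifferential of $f$ at $y$); for each $u\in\operatorname{dom}(\partial h^* )$, $\partial h^*(u)\in X$ denotes one fixed chosen element of $\operatorname{argmax}_{x\in X}\{\langle u,x\rangle-h(x)\}$ (the subdifferential of $h^*$ at $u$). Standing assumption: $-\partial f(y)\in\operatorname{dom}(\partial h^* )$ for all $y\in\operatorname{dom}(\partial f)$, and $\partial h^*(u)\in\operatorname{dom}(\partial f)$ for all $u\in\operatorname{dom}(\partial h^* )$. Generalized Bregman distances: $D_f(y,x)=f(y)-f(x)-\langle\partial f(x),y-x\rangle$ for $x\in\operatorname{dom}(\partial f)$, $y\in\operatorname{dom}(f)$, and $D_{h^*}(v,u)=h^*(v)-h^*(u)-\langle v-u,\partial h^*(u)\rangle$ for $u\in\operatorname{dom}(\partial h^* )$, $v\in\operatorname{dom}(h^* )$, with the chosen subgradients. Relative $\gamma$-curvature: $f$ has $\gamma$-curvature relative to $h$ with (finite) constant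 $C$ if for all $x\in\operatorname{dom}(\partial f)$ and $v\in\operatorname{dom}(\partial h^* )$, with $s=\partial h^*(v)$, one has $D_f(x+\alpha(s-x),x)\le C\alpha^\gamma/\gamma$ for all $\alpha\in[0,1]$. Correspondingly (with subgradient oracle $\partial\tilde f(w)=-\partial f(-w)$ for $\tilde f^{**}=\tilde f$), $h^*$ has $\gamma$-curvature relative to $\tilde f^*$ with (finite) constant $C^*$ if for all $v\in\operatorname{dom}(\partial h^* )$ and all $y\in\operatorname{dom}(\partial f)$, with $z=\partial f(y)$, one has $D_{h^*}(v+\alpha(-z-v),v)\le C^*\alpha^\gamma/\gamma$ for all $\alpha\in[0,1]$. Primal-dual hybrid algorithm: given $x_0\in\operatorname{dom}(\partial f)$ and $u_0\in-\operatorname{dom}(\partial h^* )$, for $k=0,1,2,\dots$: $(s_k,z_k):=(\partial h^*(-u_k),\partial f(x_k))$, pick $\alpha_k\in[0,1]$, $(x_{k+1},u_{k+1}):=(1-\alpha_k)(x_k,u_k)+\alpha_k(s_k,z_k)$. The iterates are understood to be well defined, i.e. $x_k\in\operatorname{dom}(\partial f)$ and $-u_k\in\operatorname{dom}(\partial h^* )$ for all $k$. *)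

(* Defs.v *)
From HB Require Import structures.
From mathcomp Require Import all_boot all_order all_algebra.
From mathcomp Require Import all_classical all_reals all_analysis.
Set Implicit Arguments.
Unset Strict Implicit.
Unset Printing Implicit Defensive.
Import Order.TTheory GRing.Theory Num.Theory.
Import numFieldNormedType.Exports.
Local Open Scope classical_set_scope.
Local Open Scope ring_scope.
Local Open Scope ereal_scope.

(* A finite-dimensional real vector space is X : vectType R with R : realType;
   its dual is 'Hom(X, R^o), and the pairing <u, x> is the application u x. *)

Section ConvexAnalysis.
Context {R : realType} {X : vectType R}.
Implicit Types (f h : X -> \bar R) (u v : 'Hom(X, R^o)) (x y : X).

Definition proper f : Prop :=
  (forall x, f x != -oo) /\ (exists x, f x != +oo).

(* For f with values in R `|` {+oo}; note 0 * +oo = 0 in \bar R. *)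
Definition convex_fun f : Prop :=
  forall x y (t : R), (0 <= t <= 1)%R ->
    f ((1 - t) *: x + t *: y)%R <= (1 - t)%:E * f x + t%:E * f y.

(* f has a closed epigraph.  A vectType carries no topology: the canonical
   topology of X is the one transported from 'rV[R]_(dim X) by the linear
   isomorphism r2v (any other linear isomorphism gives the same one). *)
Definition closed_fun f : Prop :=
  closed [set p : 'rV[R]_(dim X) * R | f (VectorInternalTheory.r2v p.1) <= p.2%:E].

Definition proper_closed_convex f : Prop :=
  [/\ proper f, closed_fun f & convex_fun f].

Definition conjugate f : 'Hom(X, R^o) -> \bar R :=
  fun u => ereal_sup (range (fun x => (u x : R)%:E - f x)).

End ConvexAnalysis.

Definition argmax {R : realType} {T : Type} (F : T -> \bar R) : set T :=
  [set a | forall b, F b <= F a].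

Definition argmin_on {R : realType} {T : Type} (A : set T) (F : T -> \bar R) :
    set T :=
  [set a | A a /\ forall b, A b -> F a <= F b].

Section Subdifferentials.
Context {R : realType} {X : vectType R}.
Implicit Types (f h : X -> \bar R) (gf : X -> 'Hom(X, R^o))
  (gh : 'Hom(X, R^o) -> X).

Definition subdiff f (y : X) : set 'Hom(X, R^o) :=
  argmax (fun v : 'Hom(X, R^o) => (v y : R)%:E - conjugate f v).

(* The subdifferential of the conjugate of h, as a set of primal vectors. *)
Definition subdiff_conj h (u : 'Hom(X, R^o)) : set X :=
  argmax (fun x => (u x : R)%:E - h x).

Definition dom_subdiff f : set X := [set y | subdiff f y !=set0].

Definition dom_subdiff_conj h : set 'Hom(X, R^o) :=
  [set u | subdiff_conj h u !=set0].

(* Oracles are total functions, constrained only on the domain of the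
   subdifferential. *)
Definition subgradient_oracle f gf : Prop :=
  forall y, dom_subdiff f y -> subdiff f y (gf y).

Definition conj_subgradient_oracle h gh : Prop :=
  forall u, dom_subdiff_conj h u -> subdiff_conj h u (gh u).

Definition oracles_compatible f h gf gh : Prop :=
  (forall y, dom_subdiff f y -> dom_subdiff_conj h (- gf y)%R) /\
  (forall u, dom_subdiff_conj h u -> dom_subdiff f (gh u)).

Definition bregman f gf (y x : X) : \bar R :=
  f y - f x - (gf x (y - x)%R : R)%:E.

Definition bregman_conj h gh (v u : 'Hom(X, R^o)) : \bar R :=
  conjugate h v - conjugate h u - ((v - u)%R (gh u) : R)%:E.

Definition reflect_fun f : X -> \bar R := fun y => f (- y)%R.

Definition reflect_oracle gf : X -> 'Hom(X, R^o) := fun w => (- gf (- w))%R.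

End Subdifferentials.

(* Relative curvature of a function on V with Bregman distance D and
   subdifferential domain A: the target s runs over the values taken on B by
   the oracle g of the conjugate of the reference function. *)
Definition rel_curvature {R : realType} {V : lmodType R} {W : Type}
    (D : V -> V -> \bar R) (A : set V) (B : set W) (g : W -> V)
    (gamma C : R) : Prop :=
  forall x w, A x -> B w ->
    forall alpha : R, (0 <= alpha <= 1)%R ->
      D (x + alpha *: (g w - x))%R x <= (C * alpha `^ gamma / gamma)%:E.

Section Curvature.
Context {R : realType} {X : vectType R}.
Implicit Types (f h : X -> \bar R) (gf : X -> 'Hom(X, R^o))
  (gh : 'Hom(X, R^o) -> X).

(* f has gamma-curvature relative to h with constant C. *)
Definition curvature f h gf gh (gamma C : R) : Prop :=
  rel_curvature (bregman f gf) (dom_subdiff f) (dom_subdiff_conj h) gh gamma C.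

(* The conjugate of h has gamma-curvature relative to the conjugate of f0
   with constant C, where g0 is the oracle of f0 = f0^**. *)
Definition conj_curvature h f0 gh (g0 : X -> 'Hom(X, R^o)) (gamma C : R) :
    Prop :=
  rel_curvature (bregman_conj h gh) (dom_subdiff_conj h) (dom_subdiff f0) g0
    gamma C.

Lemma subdiff_reflect f (w : X) v :
  subdiff (reflect_fun f) w v <-> subdiff f (- w)%R (- v)%R.
Proof.
have E (u : 'Hom(X, R^o)) : conjugate (reflect_fun f) u = conjugate f (- u)%R.
  congr ereal_sup; apply/seteqP; split=> _ [x _ <-]; exists (- x)%R => //=.
    by rewrite opp_lfunE linearN /= opprK.
  by rewrite /reflect_fun opprK opp_lfunE linearN.
rewrite /subdiff /argmax /=; split=> H b.
  have := H (- b)%R; rewrite !E opprK.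
  by rewrite !opp_lfunE !linearN /= opprK.
have := H (- b)%R; rewrite !E.
by rewrite !opp_lfunE !linearN /= !opprK.
Qed.

(* With f0 the reflection of f, the oracle values are the - gf y with y in the
   domain of the subdifferential of f. *)
Lemma conj_curvature_reflectE f h gf gh (gamma C : R) :
  conj_curvature h (reflect_fun f) gh (reflect_oracle gf) gamma C <->
  forall v y, dom_subdiff_conj h v -> dom_subdiff f y ->
    forall alpha : R, (0 <= alpha <= 1)%R ->
      bregman_conj h gh (v + alpha *: (- gf y - v))%R v
        <= (C * alpha `^ gamma / gamma)%:E.
Proof.
split=> H v y Av By a a01.
  have := H v (- y)%R Av _ a a01; rewrite /reflect_oracle opprK; apply.
  case: By => z zy; exists (- z)%R; apply/subdiff_reflect.
  by rewrite !opprK.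
apply: H => //; case: By => z /subdiff_reflect zy.
by exists (- z)%R.
Qed.

(* The iterates of the primal-dual hybrid algorithm, required to stay in the
   domains of the two oracles. *)
Record hybrid_iterates f h gf gh (x : nat -> X) (u : nat -> 'Hom(X, R^o))
    (s : nat -> X) (z : nat -> 'Hom(X, R^o)) (alpha : nat -> R) : Prop := {
  hybrid_domx : forall k, dom_subdiff f (x k);
  hybrid_domu : forall k, dom_subdiff_conj h (- u k)%R;
  hybrid_s : forall k, s k = gh (- u k)%R;
  hybrid_z : forall k, z k = gf (x k);
  hybrid_alpha : forall k, (0 <= alpha k <= 1)%R;
  hybrid_x : forall k,
    x k.+1 = ((1 - alpha k) *: x k + alpha k *: s k)%R;
  hybrid_u : forall k,
    u k.+1 = ((1 - alpha k) *: u k + alpha k *: z k)%R }.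

End Curvature.

(* Main.v *)
(* Write G_k = f(x_k) + h(x_k) + f^*(u_k) + h^*(-u_k) for the duality gap.
   Expanding f and h^* at x_k and -u_k by their Bregman distances, bounding h
   and f^* by convexity and using the Fenchel equalities
   f(x_k) + f^*(z_k) = <z_k, x_k> and h(s_k) + h^*(-u_k) = -<u_k, s_k> gives
   G_{k+1} <= (1 - alpha_k) G_k + (the two Bregman distances of step k), so
   G_k <= H_k for k >= 1.  Curvature and the line search give
   H_{k+1} <= (1 - a) H_k + (C + C^* ) a^gamma / gamma for every a in [0, 1]; with
   a = gamma / (k + gamma) the rate follows by induction from the Bernoulli
   inequality (1 + t)^(-p) >= 1 - p t at t = 1 / (k + gamma), p = gamma - 1.

   The first Fenchel equality amounts to f^** = f at x_k.  It is obtained by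
   projecting points lying strictly below the graph onto the epigraph of f. *)
Require Import Defs.
From HB Require Import structures.
From mathcomp Require Import all_boot all_order all_algebra.
From mathcomp Require Import all_classical all_reals all_analysis.
From mathcomp Require Import ring lra.
Import Order.TTheory GRing.Theory Num.Theory.
Import numFieldNormedType.Exports.
Import VectorInternalTheory.
Local Open Scope classical_set_scope.
Local Open Scope ring_scope.

(** * Scalar inequalities behind the rate *)

(** With the power written as [expR (- p * ln (1 + t))], this combines [1 + y <= expR y] and
    [ln (1 + t) <= t]. *)
Lemma bernoulli_powRN {R : realType} (p t : R) :
  0 <= p -> 0 <= t -> 1 - p * t <= (1 + t) `^ (- p).
Proof.
move=> p0 t0; rewrite /powR gt_eqF; last by lra.
apply: le_trans (expR_ge1Dx _); rewrite mulNr lerD2l lerN2 ler_wpM2l //.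
by apply: le_ln1Dx; lra.
Qed.

(** With [a = gamma / (k + gamma)], the left side factors as [a^(gamma - 1) (1 - (gamma - 1) / (k +
    gamma))], and the next ratio is [a / (1 + 1 / (k + gamma))]; Bernoulli compares the two. *)
Lemma rate_step {R : realType} (gamma k : R) : 1 < gamma -> 0 <= k ->
  (1 - gamma / (k + gamma)) * (gamma / (k + gamma)) `^ (gamma - 1)
    + (gamma / (k + gamma)) `^ gamma / gamma
  <= (gamma / (k + 1 + gamma)) `^ (gamma - 1).
Proof.
move=> g1 k0; set a := gamma / (k + gamma).
have a0 : 0 < a by rewrite divr_gt0; lra.
have -> : gamma / (k + 1 + gamma) = a * (1 + (k + gamma)^-1) `^ (-1).
  by rewrite powR_inv1; [rewrite /a; field|rewrite addr_ge0 // invr_ge0]; lra.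
rewrite (powRM _ (ltW a0) (powR_ge0 _ _)) -powRrM mulN1r.
rewrite -(@mulr_powRB1 _ a gamma (ltW a0)); last by lra.
have -> : (1 - a) * a `^ (gamma - 1) + a * a `^ (gamma - 1) / gamma
    = a `^ (gamma - 1) * (1 - (gamma - 1) * (k + gamma)^-1).
  by rewrite /a; field; lra.
rewrite ler_wpM2l ?powR_ge0 // bernoulli_powRN ?invr_ge0 //; lra.
Qed.

(** * Euclidean projection onto closed convex sets *)

Definition dotv {R : realType} {n : nat} (p q : 'rV[R]_n) : R :=
  (\sum_i p 0 i * q 0 i).

Lemma dotvC {R : realType} {n} (p q : 'rV[R]_n) : dotv p q = dotv q p.
Proof. by apply: eq_bigr => i _; rewrite mulrC. Qed.

Lemma dotv_is_linear {R : realType} {n} (q : 'rV[R]_n) :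
  linear (fun p => dotv p q : R^o).
Proof.
move=> c p p'; rewrite /dotv scaler_sumr -big_split; apply: eq_bigr => i _.
by rewrite !mxE mulrDl -mulrA.
Qed.

Lemma dotvD {R : realType} {n} (q p p' : 'rV[R]_n) :
  dotv (p + p') q = (dotv p q + dotv p' q).
Proof. by have := dotv_is_linear q 1 p p'; rewrite !scale1r. Qed.

Lemma dotvZ {R : realType} {n} (q : 'rV[R]_n) c p :
  dotv (c *: p) q = (c * dotv p q).
Proof.
have := dotv_is_linear q c p 0; rewrite addr0 => ->.
suff -> : dotv 0 q = 0 by rewrite addr0.
by rewrite /dotv big1 // => i _; rewrite mxE mul0r.
Qed.

Lemma dotv_ge0 {R : realType} {n} (p : 'rV[R]_n) : (0 <= dotv p p).
Proof. by apply: sumr_ge0 => i _; rewrite -expr2 sqr_ge0. Qed.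

Lemma dotv_eq0 {R : realType} {n} (p : 'rV[R]_n) : dotv p p = 0 -> p = 0.
Proof.
move=> /psumr_eq0P p0; apply/rowP => i; rewrite mxE; apply/eqP.
by rewrite -(sqrf_eq0 (p 0 i)) expr2 p0 // => j _; rewrite -expr2 sqr_ge0.
Qed.

Lemma dotv_sqrD {R : realType} {n} (t : R) (p q : 'rV[R]_n) :
  dotv (t *: p + q) (t *: p + q)
  = t ^+ 2 * dotv p p + 2 * t * dotv p q + dotv q q.
Proof.
rewrite dotvD dotvZ (dotvC p) (dotvC q) !dotvD !dotvZ.
by rewrite (dotvC q p); ring.
Qed.

Lemma dotv_row_mx {R : realType} {m n} (p p' : 'rV[R]_m) (q q' : 'rV[R]_n) :
  dotv (row_mx p q) (row_mx p' q') = (dotv p p' + dotv q q').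
Proof.
rewrite /dotv big_split_ord /=; congr (_ + _); apply: eq_bigr => i _.
  by rewrite !row_mxEl.
by rewrite !row_mxEr.
Qed.

(** The squared distance to [a] attains its minimum on the compact set of points of [K] no farther
    from [a] than [p0]. Moving from the minimizer towards [q] stays in [K], so it cannot decrease
    the distance. *)
Lemma closed_convex_projection {R : realType} {n} (K : set 'rV[R]_n)
    (a : 'rV[R]_n) :
  K !=set0 -> closed K ->
  (forall p q (t : R), K p -> K q -> (0 <= t <= 1) ->
    K ((1 - t) *: p + t *: q)) ->
  exists2 p, K p & forall q, K q -> (dotv (q - p) (a - p) <= 0).
Proof.
move=> [p0 Kp0] cK convK.
pose g (p : 'rV[R]_n) : R := dotv (a - p) (a - p).
have cg : continuous g.
  apply: continuous_big => [|i _]; first exact: add_continuous.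
  have c1 : continuous (fun p : 'rV[R]_n => (a - p) 0 i : R).
    rewrite (_ : (fun p => _) = (fun p : 'rV[R]_n => a 0 i - p 0 i)); last first.
      by apply/funext => p; rewrite !mxE.
    move=> p; apply: continuousB; first exact: cst_continuous.
    exact: (@coord_continuous R 1 n 0 i).
  by move=> p; apply: continuousM; exact: c1.
(* This box contains the sublevel set because [2 |c| <= 1 + c^2] for each coordinate difference
   [c]. *)
pose B := [set p : 'rV[R]_n | forall i,
  `[a 0 i - (1 + g p0), a 0 i + (1 + g p0)]%classic (p 0 i)].
have cA : compact (K `&` [set p | g p <= g p0]).
  apply: (@subclosed_compact _ _ B).
  - apply: closedI => //; apply: (@preimage_closed _ _ g [set r | r <= g p0]).
      by move=> p _; exact: cg.
    exact: closed_le.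
  - apply: (@rV_compact _ _ (fun i =>
      `[a 0 i - (1 + g p0), a 0 i + (1 + g p0)]%classic)) => i.
    exact: segment_compact.
  - move=> p [_ /= gp] i /=; rewrite in_itv /=.
    have : ((a 0 i - p 0 i) ^+ 2 <= g p0).
      apply: le_trans gp; rewrite /g /dotv (bigD1 i) //= !mxE -expr2 lerDl.
      by apply: sumr_ge0 => j _; rewrite -expr2 sqr_ge0.
    have := sqr_ge0 (a 0 i - p 0 i); have := sqr_ge0 (a 0 i - p 0 i - 1).
    by have := sqr_ge0 (a 0 i - p 0 i + 1) => ? ? ? ?; apply/andP; split; lra.
have [p pA pmin] := compact_EVT_min (ex_intro _ p0 (conj Kp0 (lexx _))) cA
  (continuous_subspaceT cg).
move: pA; rewrite inE => -[Kp /= gp].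
have {}pmin q : K q -> (g p <= g q).
  move=> Kq; have [gq|/ltW gq] := leP (g q) (g p0); last exact: le_trans gp gq.
  by apply: pmin; rewrite inE.
exists p => // q Kq.
set c := dotv _ _; pose d := dotv (q - p) (q - p).
have d0 : (0 <= d) by exact: dotv_ge0.
have ct (t : R) : (0 <= t <= 1) -> (0 <= t * (t * d - 2 * c)).
  move=> t01; have := pmin _ (convK _ _ _ Kp Kq t01).
  rewrite /g (_ : a - (_ + _) = (- t) *: (q - p) + (a - p)); last first.
    by apply/rowP => i; rewrite !mxE; ring.
  by rewrite dotv_sqrD -/c -/d; lra.
rewrite leNgt; apply/negP => c0.
have cd : (0 < c + d) by lra.
(* If [c > 0], the step [t = c / (c + d)] gives [t d < 2 c], contradicting [ct]; it is admissible
   even when [d = 0]. *)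
have t01 : (0 <= c / (c + d) <= 1).
  by rewrite divr_ge0 ?(ltW c0) ?(ltW cd) //= ler_pdivrMr // mul1r lerDl.
have t0 : 0 < c / (c + d) by rewrite divr_gt0.
have := ct _ t01; rewrite pmulr_rge0 // mulrAC -mulrA.
have : d / (c + d) <= 1 by rewrite ler_pdivrMr // mul1r lerDr ltW.
by nra.
Qed.

(** * Separation from the epigraph and affine minorants *)

Lemma dotv_hom {R : realType} {X : vectType R} (q : 'rV[R]_(dim X)) :
  exists v : 'Hom(X, R^o),
    forall y, v y = dotv (v2r y) q :> R.
Proof.
have lin : linear (fun y : X => dotv (v2r y) q : R^o).
  by move=> c y y'; rewrite linearD linearZ; exact: dotv_is_linear.
pose L := GRing.isLinear.Build R X R^o *:%R _ lin.
pose F : {linear X -> R^o} :=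
  HB.pack (fun y : X => dotv (v2r y) q : R^o) L.
by exists (linfun F) => y; rewrite lfunE.
Qed.

Local Open Scope ereal_scope.

(* (y0, t0) is the projection of (x, r) onto the epigraph, and m is the inner
   product with x - y0. *)
Lemma epigraph_separation {R : realType} {X : vectType R} (f : X -> \bar R)
    (x : X) (r : R) :
  proper_closed_convex f ->
  exists (y0 : X) (t0 : R) (m : 'Hom(X, R^o)),
    [/\ f y0 <= t0%:E, (0 <= m (x - y0) :> R)%R,
        (m (x - y0) = 0 :> R)%R -> x = y0 &
        forall y (t : R), f y <= t%:E ->
          ((m (y - y0) : R) + (t - t0) * (r - t0) <= 0 :> R)%R].
Proof.
move=> [[fNoo [x1 fx1]] cf convf].
(* The epigraph is flattened into row vectors of length [dim X + 1], where the projection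
   applies. *)
pose K := [set w : 'rV[R]_(dim X + 1) |
  f (r2v (lsubmx w)) <= (rsubmx w 0 0)%:E].
have cK : closed K.
  pose e (w : 'rV[R]_(dim X + 1)) := (lsubmx w, rsubmx w 0%R 0%R : R).
  have c2 : continuous (fun w : 'rV[R]_(dim X + 1) => rsubmx w 0%R 0%R : R).
    move=> w; apply: (@continuous_comp _ _ _
      (@rsubmx R 1 (dim X) 1) (fun M => M 0%R 0%R)).
      exact: continuous_rsubmx.
    exact: coord_continuous.
  apply: (@preimage_closed _ _ e _ _ cf) => w _.
  exact: (cvg_pair (@continuous_lsubmx R 1 (dim X) 1 w) (c2 w)).
have KE y (t : R) : K (row_mx (v2r y) (const_mx t)) = (f y <= t%:E).
  by rewrite /K /= row_mxKl row_mxKr mxE v2rK.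
have nK : K !=set0.
  exists (row_mx (v2r x1) (const_mx (fine (f x1)))).
  by rewrite KE fineK // fin_numE fNoo.
have convK p q (t : R) : K p -> K q -> (0 <= t <= 1)%R ->
    K ((1 - t) *: p + t *: q)%R.
  move=> Kp Kq t01; rewrite /K /= !linearP /= !linearZ /=.
  rewrite (le_trans (convf _ _ _ t01)) // !mxE.
  move: Kp Kq; rewrite /K /= !mxE => Kp Kq.
  rewrite [leRHS]EFinD !EFinM.
  case/andP: t01 => t0 t1.
  by apply: leeD; apply: lee_wpmul2l => //; rewrite lee_fin // subr_ge0.
have [p Kp Hp] := closed_convex_projection K
  (row_mx (v2r x) (const_mx r)) nK cK convK.
pose y0 := r2v (lsubmx p); pose t0 : R := rsubmx p 0%R 0%R.
have [m mE] := dotv_hom (v2r x - v2r y0)%R.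
have pE : p = row_mx (v2r y0) (const_mx t0).
  rewrite -[p]hsubmxK; congr row_mx; first by rewrite r2vK.
  by apply/matrixP => i j; rewrite [RHS]mxE !ord1.
exists y0, t0, m; split.
- by rewrite -KE -pE.
- by rewrite mE linearB; exact: dotv_ge0.
- rewrite mE linearB => /dotv_eq0 /eqP; rewrite subr_eq0 => /eqP.
  exact: v2r_inj.
- move=> y t fy; have := Hp (row_mx (v2r y) (const_mx t)).
  rewrite KE => /(_ fy); rewrite pE !opp_row_mx !add_row_mx dotv_row_mx.
  by rewrite mE linearB {2}/dotv big_ord1 !mxE.
Qed.

(** The separating hyperplane has normal [(m, r - t0)]. If [r < t0], dividing by [t0 - r] yields a
    minorant; otherwise [r = t0] and the hyperplane is vertical. *)
Lemma affine_minorant_or_vertical {R : realType} {X : vectType R}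
    (f : X -> \bar R) (x : X) (r : R) :
  proper_closed_convex f -> r%:E < f x ->
  (exists v : 'Hom(X, R^o), forall y, (r + (v (y - x)%R : R))%:E <= f y) \/
  (exists (m : 'Hom(X, R^o)) (y0 : X), (0 < m (x - y0) :> R)%R /\
    forall y, f y != +oo -> (m (y - y0) <= 0 :> R)%R).
Proof.
move=> pcc rfx; have [[fNoo _] _ _] := pcc.
have [y0 [t0 [m [fy0 m0 m_eq0 Hm]]]] := epigraph_separation f x r pcc.
have fineE y : f y != +oo -> f y = (fine (f y))%:E.
  by move=> fy; rewrite fineK // fin_numE fNoo.
have [rt0|t0r] := ltP r t0.
  left; exists ((t0 - r)^-1 *: m)%R => y; rewrite scale_lfunE.
  have [->|/fineE fyE] := eqVneq (f y) +oo; first by rewrite leey.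
  have := Hm y (fine (f y)); rewrite -fyE lexx => /(_ isT).
  rewrite -[(y - y0)%R](subrKA x) linearD /= => Hy.
  rewrite [leRHS]fyE lee_fin.
  rewrite -[_ *: _]/(_ * _)%R addrC -lerBrDr mulrC ler_pdivrMr ?subr_gt0 //.
  move: (m (y - x)%R : R) (m (x - y0)%R : R) (fine _) m0 Hy => a b t ? ?.
  by have := sqr_ge0 (t0 - r); lra.
right; exists m, y0; split.
  rewrite lt_neqAle m0 andbT eq_sym; apply/eqP => /m_eq0 xy0.
  by move: rfx; rewrite xy0 ltNge (le_trans fy0).
(* The epigraph contains [(y0, t0 + 1)], and testing the separation there forces [r <= t0]. *)
have rt0 : r = t0.
  apply/eqP; rewrite eq_le t0r andbT.
  have := Hm y0 (t0 + 1)%R; rewrite subrr linear0 (le_trans fy0).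
    by move=> /(_ isT); lra.
  by rewrite lee_fin lerDl.
move=> y /fineE fyE; have := Hm y (fine (f y)); rewrite -fyE lexx => /(_ isT).
by rewrite rt0 subrr mulr0 addr0.
Qed.

(** Below a domain point [x1] the vertical case is impossible, so some minorant exists. Adding a
    large multiple of the vertical functional, nonpositive on the domain of [f], lifts it to at
    least [r] at [x]. *)
Lemma affine_minorant {R : realType} {X : vectType R} (f : X -> \bar R)
    (x : X) (r : R) :
  proper_closed_convex f -> r%:E < f x ->
  exists v : 'Hom(X, R^o), forall y, (r + (v (y - x)%R : R))%:E <= f y.
Proof.
move=> pcc rfx; have [[fNoo [x1 fx1]] _ _] := pcc.
have [//|[m [y0 [mx Hm]]]] := affine_minorant_or_vertical f x r pcc rfx.
have fx1E : f x1 = (fine (f x1))%:E by rewrite fineK // fin_numE fNoo.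
pose r1 := (fine (f x1) - 1)%R.
have r1f : r1%:E < f x1 by rewrite [ltRHS]fx1E lte_fin /r1; lra.
have [[v1 Hv1]|[m1 [y1 [m1x Hm1]]]] :=
  affine_minorant_or_vertical f x1 r1 pcc r1f; last first.
  by have := Hm1 _ fx1; rewrite leNgt m1x.
(* Tilting the minorant v1 along the vertical hyperplane m. *)
pose c : R := (`|r - r1 - v1 (x - x1)| / m (x - y0))%R.
exists (v1 + c *: m)%R => y.
have [->|fy] := eqVneq (f y) +oo; first by rewrite leey.
apply: le_trans (Hv1 y); rewrite lee_fin add_lfunE scale_lfunE.
rewrite -[_ *: _]/(_ * _)%R.
have c0 : (0 <= c)%R by rewrite divr_ge0 // ltW.
have cm : (c * m (x - y0) = `|r - r1 - v1 (x - x1)|)%R.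
  by rewrite /c divfK // gt_eqF.
have := ler_norm (r - r1 - v1 (x - x1))%R; rewrite -cm.
have := mulr_ge0_le0 c0 (Hm y fy).
have -> : (m (y - y0) = m (y - x) + m (x - y0))%R by rewrite -linearD subrKA.
have -> : (v1 (y - x1) = v1 (y - x) + v1 (x - x1))%R.
  by rewrite -linearD subrKA.
by rewrite mulrDr; lra.
Qed.

(** * Conjugates and Fenchel equalities *)

Lemma conjugate_leP {R : realType} {X : vectType R} (f : X -> \bar R)
    (u : 'Hom(X, R^o)) (A : R) :
  conjugate f u <= A%:E <-> forall y, ((u y : R) - A)%:E <= f y.
Proof.
have E y : ((u y : R)%:E - f y <= A%:E) = (((u y : R) - A)%:E <= f y).
  by case: (f y) => [t| |] //=; rewrite ?leey ?leNye // !lee_fin; lra.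
split=> [Hu y|Hu].
  by rewrite -E (le_trans _ Hu) //; apply: ereal_sup_ubound; exists y.
by apply: ge_ereal_sup => _ [y _ <-]; rewrite E.
Qed.

Lemma fenchel_young {R : realType} {X : vectType R} (f : X -> \bar R)
    (u : 'Hom(X, R^o)) (y : X) : (u y : R)%:E - f y <= conjugate f u.
Proof. by apply: ereal_sup_ubound; exists y. Qed.

Lemma conjugate_gtNy {R : realType} {X : vectType R} (f : X -> \bar R)
    (u : 'Hom(X, R^o)) : Defs.proper f -> conjugate f u != -oo.
Proof.
move=> [fNoo [x fx]]; rewrite -ltNye (lt_le_trans _ (fenchel_young f u x)) //.
by move: (fNoo x) fx; case: (f x) => // t _ _; rewrite -EFinB ltNyr.
Qed.

(* Fenchel-Moreau at points of the domain of the subdifferential: here subdiff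
   is defined through f^*, so this needs f^** = f. *)
Lemma subdiff_fenchel_eq {R : realType} {X : vectType R} (f : X -> \bar R)
    (y : X) (z : 'Hom(X, R^o)) :
  proper_closed_convex f -> subdiff f y z ->
  exists F G : R,
    [/\ f y = F%:E, conjugate f z = G%:E & (F + G = z y :> R)%R].
Proof.
move=> pcc zmax; have [pf _ _] := pcc; have [fNoo [x1 fx1]] := pf.
have conj_minorant (w : X) (r : R) (v : 'Hom(X, R^o)) :
    (forall x, (r + (v (x - w)%R : R))%:E <= f x) ->
    conjugate f v <= ((v w : R) - r)%:E.
  move=> Hv; apply/conjugate_leP => x; apply: le_trans (Hv x).
  by rewrite lee_fin linearB /=; lra.
have fx1E : f x1 = (fine (f x1))%:E by rewrite fineK // fin_numE fNoo.
(* A minorant of [f] bounds the conjugate at [v1], so the maximizer [z] must have a finite conjugate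
   value. *)
have [|v1 /conj_minorant Hv1] := affine_minorant f x1 (fine (f x1) - 1)%R pcc.
  by rewrite [ltRHS]fx1E lte_fin; lra.
have [G zG] : exists G : R, conjugate f z = G%:E.
  move: (zmax v1) Hv1 (conjugate_gtNy f v1 pf) (conjugate_gtNy f z pf).
  case: (conjugate f z) => [G _ _ _ _| |] //; first by exists G.
  by case: (conjugate f v1).
(* Each level [r] below [f y] gives a slope [v] with conjugate at most [v y - r]; maximality of [z]
   transfers the bound. *)
have Hr (r : R) : r%:E < f y -> (r <= z y - G)%R.
  move=> /(affine_minorant f y r pcc)[v /conj_minorant Hv].
  rewrite -lee_fin EFinB -zG (le_trans _ (zmax v)) //.
  move: Hv (conjugate_gtNy f v pf); case: (conjugate f v) => // B.
  by rewrite -EFinB !lee_fin => ? _; lra.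
have fyG : ((z y : R) - G)%:E <= f y by apply: (conjugate_leP f z G).1; rewrite zG.
move: fyG Hr (fNoo y); case: (f y) => [F| |] // yG Hr _.
  exists F, G; split=> //; move: yG; rewrite lee_fin => yG.
  apply/eqP; rewrite eq_le; apply/andP; split; last by lra.
  rewrite leNgt; apply/negP => FG.
  (* The midpoint is a level below [F] but still above [z y - G]. *)
  have := Hr ((F + (z y - G)) / 2)%R; rewrite lte_fin => H.
  by have : ((F + (z y - G)) / 2 < F)%R; [lra|move/H; lra].
by have := Hr (z y - G + 1)%R (ltry _); lra.
Qed.

(** Maximality of [s] says directly that the supremum defining the conjugate is attained at [s];
    properness makes both values finite. *)
Lemma subdiff_conj_fenchel_eq {R : realType} {X : vectType R}
    (h : X -> \bar R) (u : 'Hom(X, R^o)) (s : X) :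
  Defs.proper h -> subdiff_conj h u s ->
  exists F G : R,
    [/\ h s = F%:E, conjugate h u = G%:E & (F + G = u s :> R)%R].
Proof.
move=> ph smax; have [hNoo [x1 hx1]] := ph.
have cE : conjugate h u = (u s : R)%:E - h s.
  apply/eqP; rewrite eq_le fenchel_young andbT.
  by apply: ge_ereal_sup => _ [y _ <-]; exact: smax.
rewrite cE; move: (smax x1) (hNoo x1) (hNoo s) hx1.
case: (h s) => [F| |] //; last by case: (h x1).
by exists F, (u s - F)%R; split=> //; lra.
Qed.

(** A convex combination of two affine minorants of [f] is again a minorant. *)
Lemma conjugate_convex {R : realType} {X : vectType R} (f : X -> \bar R)
    (u v : 'Hom(X, R^o)) (A B t : R) :
  (0 <= t <= 1)%R -> conjugate f u <= A%:E -> conjugate f v <= B%:E ->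
  conjugate f ((1 - t) *: u + t *: v)%R <= ((1 - t) * A + t * B)%:E.
Proof.
move=> /andP[t0 t1] /conjugate_leP Hu /conjugate_leP Hv.
apply/conjugate_leP => y; move: (Hu y) (Hv y).
rewrite add_lfunE !scale_lfunE -![_ *: _]/(_ * _)%R.
case: (f y) => [F| |] //; last by move=> _ _; rewrite leey.
rewrite !lee_fin; move: (u y : R) (v y : R) => a b Ha Hb.
have := ler_wpM2l t0 Hb; have : (0 <= 1 - t)%R by rewrite subr_ge0.
by move=> /ler_wpM2l /(_ _ _ Ha); lra.
Qed.

(** * Bregman distances, the gap recursion and the rate *)

(** The Fenchel equality at [x] turns the distance into [f y - (gf x y - G)], the slack in the
    Fenchel-Young inequality. *)
Lemma bregman_ge0 {R : realType} {X : vectType R} (f : X -> \bar R)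
    (gf : X -> 'Hom(X, R^o)) (y x : X) :
  proper_closed_convex f -> subdiff f x (gf x) -> 0 <= bregman f gf y x.
Proof.
move=> pcc /(subdiff_fenchel_eq _ _ _ pcc) [F [G [fx cG FG]]].
rewrite /bregman fx.
have : ((gf x y : R) - G)%:E <= f y.
  by apply: (conjugate_leP f (gf x) G).1; rewrite cG.
case: (f y) => [t| |] //; last by rewrite !addye // leey.
by rewrite -!EFinB !lee_fin linearB /=; lra.
Qed.

Lemma bregman_conj_ge0 {R : realType} {X : vectType R} (h : X -> \bar R)
    (gh : 'Hom(X, R^o) -> X) (v u : 'Hom(X, R^o)) :
  Defs.proper h -> subdiff_conj h u (gh u) -> 0 <= bregman_conj h gh v u.
Proof.
move=> ph /(subdiff_conj_fenchel_eq _ _ _ ph) [F [G [hs cG FG]]].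
rewrite /bregman_conj cG; have := fenchel_young h v (gh u); rewrite hs.
case: (conjugate h v) => [t| |] //; last by rewrite !addye // leey.
by rewrite -!EFinB !lee_fin add_lfunE opp_lfunE; lra.
Qed.

(* F, G, S, K stand for f(x), f^*(z), h(s), h^*(-u) and F', K' for the values
   at the next iterates; A and B bound f^*(u) and h(x). *)
Lemma hybrid_gap_step {R : realType} {X : vectType R} (x s x' : X)
    (u z u' : 'Hom(X, R^o)) (a F G S K F' K' A B : R) :
  (F + G = z x :> R)%R -> (S + K = (- u) s :> R)%R ->
  x' = ((1 - a) *: x + a *: s)%R -> u' = ((1 - a) *: u + a *: z)%R ->
  (F' + ((1 - a) * B + a * S) + ((1 - a) * A + a * G) + K'
   = (1 - a) * (F + B + A + K) + (F' - F - z (x' - x))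
     + (K' - K - (- u' - - u) s))%R.
Proof.
move=> FG SK -> ->.
have -> : ((1 - a) *: x + a *: s - x = a *: (s - x))%R.
  rewrite scalerBl scale1r scalerBr addrAC [(_ - _ - x)%R]addrAC subrr add0r.
  by rewrite addrC.
rewrite opp_lfunE in SK.
rewrite linearZ linearB /= !(opp_lfunE, add_lfunE, scale_lfunE).
rewrite -![_ *: _]/(_ * _)%R.
move: FG SK; move: (z x : R) (u s : R) (z s : R) => zx us zs FG SK.
have -> : F = (zx - G)%R by lra.
have -> : K = (- us - S)%R by lra.
by ring.
Qed.

Theorem theorem4 (R : realType) (X : vectType R) (f h : X -> \bar R)
    (gf : X -> 'Hom(X, R^o)) (gh : 'Hom(X, R^o) -> X)
    (f_pcc : proper_closed_convex f) (h_pcc : proper_closed_convex h)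
    (gf_oracle : subgradient_oracle f gf)
    (gh_oracle : conj_subgradient_oracle h gh)
    (compat : oracles_compatible f h gf gh)
    (gamma C Cstar : R) (gamma_gt1 : (1 < gamma)%R)
    (f_curv : curvature f h gf gh gamma C)
    (h_curv :
      conj_curvature h (reflect_fun f) gh (reflect_oracle gf) gamma Cstar)
    (x : nat -> X) (u : nat -> 'Hom(X, R^o))
    (s : nat -> X) (z : nat -> 'Hom(X, R^o)) (alpha : nat -> R)
    (iter : hybrid_iterates f h gf gh x u s z alpha)
    (alpha0 : alpha 0%N = 1%R)
    (H : nat -> \bar R)
    (H1 : H 1%N = bregman f gf (s 0%N) (x 0%N)
                  + bregman_conj h gh (- z 0%N)%R (- u 0%N)%R)
    (HS : forall k : nat, (1 <= k)%N ->
      H k.+1 =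
        (1 - alpha k)%:E * H k
        + bregman f gf ((1 - alpha k) *: x k + alpha k *: s k)%R (x k)
        + bregman_conj h gh (- ((1 - alpha k) *: u k) - alpha k *: z k)%R
            (- u k)%R)
    (line_search : forall k : nat, (1 <= k)%N ->
      argmin_on [set a : R | (0 <= a <= 1)%R]
        (fun a : R =>
          (1 - a)%:E * H k
          + bregman f gf (x k + a *: (s k - x k))%R (x k)
          + bregman_conj h gh (- u k - a *: (z k - u k))%R (- u k)%R)
        (alpha k)) :
  forall k : nat, (1 <= k)%N ->
    f (x k) + h (x k) + conjugate f (u k) + conjugate h (- u k)%R
      <= ((C + Cstar) * (gamma / (k%:R + gamma)) `^ (gamma - 1))%:E.
Proof.
have [hproper _ hconv] := h_pcc.
case: iter => domx domu sE zE alpha01 xS uS.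
have xfin k : exists F G : R, [/\ f (x k) = F%:E, conjugate f (z k) = G%:E &
    (F + G = z k (x k) :> R)%R].
  by rewrite zE; apply: subdiff_fenchel_eq => //; exact: gf_oracle.
have ufin k : exists S K : R, [/\ h (s k) = S%:E, conjugate h (- u k)%R = K%:E &
    (S + K = (- u k)%R (s k) :> R)%R].
  by rewrite sE; apply: subdiff_conj_fenchel_eq => //; exact: gh_oracle.
have {}h_curv k (a : R) : (0 <= a <= 1)%R ->
    bregman_conj h gh (- u k - a *: (z k - u k))%R (- u k)%R
    <= (Cstar * a `^ gamma / gamma)%:E.
  move=> a01; move/conj_curvature_reflectE: h_curv.
  move=> /(_ _ _ (domu k) (domx k) a a01); rewrite -zE opprK.
  by rewrite [(- z k + _)%R]addrC -opprB scalerN.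
have {}f_curv k (a : R) : (0 <= a <= 1)%R ->
    bregman f gf (x k + a *: (s k - x k))%R (x k)
    <= (C * a `^ gamma / gamma)%:E.
  by move=> a01; rewrite sE; apply: f_curv.
(* Curvature at step 1 bounds nonnegative distances; the sign is needed to scale [rate_step]. *)
have C0 : (0 <= C + Cstar)%R.
  have := f_curv 0%N 1%R; have := h_curv 0%N 1%R.
  rewrite !powR1 !mulr1 ler01 lexx => /(_ isT) hC /(_ isT) fC.
  have := le_trans (bregman_ge0 f gf _ _ f_pcc (gf_oracle _ (domx 0%N))) fC.
  have := le_trans (bregman_conj_ge0 h gh _ _ hproper
    (gh_oracle _ (domu 0%N))) hC.
  by rewrite !lee_fin !pmulr_lge0 ?invr_gt0; lra.
(* [f (x k)] and the conjugate of [h] at [- u k] are finite by the domain conditions; the other two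
   gap terms are only carried through real upper bounds [A] and [B]. *)
pose invariant k := exists A B Hk F K : R,
  [/\ f (x k) = F%:E, conjugate h (- u k)%R = K%:E,
      conjugate f (u k) <= A%:E, h (x k) <= B%:E & H k = Hk%:E] /\
  (F + B + A + K <= Hk /\
   Hk <= (C + Cstar) * (gamma / (k%:R + gamma)) `^ (gamma - 1))%R.
suff inv k : invariant k.+1.
  case=> // k _; have [A [B [Hk [F [K [[-> -> fA hB _] [gap rate]]]]]]] := inv k.
  apply: (@le_trans _ _ (F%:E + B%:E + A%:E + K%:E)).
    by rewrite !leeD.
  by rewrite -!EFinD lee_fin (le_trans gap).
elim: k => [|k [A [B [Hk [F [K [[fx hu fA hB HkE] [gap rate]]]]]]]].
  have [F [G [fx fz FG]]] := xfin 0%N.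
  have [S [K [hs hu SK]]] := ufin 0%N.
  have [F' [G' [fx' _ _]]] := xfin 1%N.
  have [S' [K' [_ hu' _]]] := ufin 1%N.
  (* The initial values of [h] and of the conjugate of [f] may be infinite; they have weight
     [1 - alpha 0 = 0], so [0] stands in for their bounds. *)
  have := hybrid_gap_step _ _ _ _ _ _ _ _ _ _ _ F' K' 0 0 FG SK (xS 0%N) (uS 0%N).
  have := xS 0%N; have := uS 0%N.
  rewrite alpha0 subrr !scale0r !add0r !scale1r !mul0r !add0r !mul1r.
  move=> u1 x1 gapE.
  have H1E : H 1%N = (F' - F - z 0%N (x 1%N - x 0%N)
      + (K' - K - (- u 1%N - - u 0%N) (s 0%N)))%R%:E.
    rewrite H1 u1 x1 /bregman /bregman_conj -{1}x1 -{1}u1 fx hu fx' hu'.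
    by rewrite -zE -sE.
  exists G, S, (F' + S + G + K')%R, F', K'; split.
    by split=> //; [rewrite u1 fz|rewrite x1 hs|rewrite H1E gapE].
  split=> //; rewrite gapE.
  have : H 1%N <= ((C + Cstar) / gamma)%:E.
    rewrite H1 mulrDl EFinD; apply: leeD.
      have := f_curv 0%N 1%R.
      rewrite powR1 ler01 lexx scale1r mulr1 (addrC (x 0%N)) subrK.
      by apply.
    have := h_curv 0%N 1%R.
    rewrite powR1 ler01 lexx scale1r mulr1 opprB addrA addNr add0r.
    by apply.
  rewrite H1E lee_fin => /le_trans; apply.
  rewrite ler_wpM2l //.
  (* At [k = 0] the ratio is 1, leaving [1 / gamma <= (gamma / (1 + gamma))^(gamma - 1)]. *)
  have := rate_step gamma 0 gamma_gt1 (lexx _).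
  by rewrite !add0r divff ?gt_eqF ?subrr ?mul0r ?add0r ?powR1 ?mul1r //; lra.
have [_ [G [_ fz _]]] := xfin k.+1.
have [S [K0 [hs _ _]]] := ufin k.+1.
have FG : (F + G = z k.+1 (x k.+1) :> R)%R.
  have [F0 [G0 []]] := xfin k.+1; rewrite fx fz => -[->] [->].
  by [].
have SK : (S + K = (- u k.+1)%R (s k.+1) :> R)%R.
  have [S1 [K1 []]] := ufin k.+1; rewrite hs hu => -[->] [->].
  by [].
have [F' [_ [fx' _ _]]] := xfin k.+2.
have [_ [K' [_ hu' _]]] := ufin k.+2.
set a := alpha k.+1.
have gapE := hybrid_gap_step _ _ _ _ _ _ _ _ _ _ _ F' K' A B FG SK
  (xS k.+1) (uS k.+1).
have HSE : H k.+2 = ((1 - a) * Hk + (F' - F - z k.+1 (x k.+2 - x k.+1))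
    + (K' - K - (- u k.+2 - - u k.+1) (s k.+1)))%R%:E.
  rewrite HS // -opprD -xS -uS HkE /bregman /bregman_conj.
  by rewrite fx hu fx' hu' -zE -sE -EFinM -!EFinB -!EFinD.
have a01 := alpha01 k.+1; move/andP: (a01) => [a0 a1].
exists ((1 - a) * A + a * G)%R, ((1 - a) * B + a * S)%R,
  (fine (H k.+2)), F', K'; split; first split => //.
- by rewrite uS conjugate_convex // fz.
- rewrite xS (le_trans (hconv _ _ _ a01)) //.
  by rewrite [leRHS]EFinD !EFinM leeD // lee_wpmul2l ?lee_fin ?subr_ge0 ?hs.
- by rewrite HSE.
(* The line search makes [H k.+2] at most its objective at any trial step [b], and curvature bounds
   that objective. *)
have Hline (b : R) : (0 <= b <= 1)%R ->
    (fine (H k.+2) <= (1 - b) * Hk + (C + Cstar) * (b `^ gamma / gamma))%R.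
  move=> b01; have [_ /(_ b b01)] := line_search k.+1 isT.
  rewrite -lee_fin fineK; last by rewrite HSE.
  have -> : H k.+2 = (1 - alpha k.+1)%:E * H k.+1
      + bregman f gf (x k.+1 + alpha k.+1 *: (s k.+1 - x k.+1))%R (x k.+1)
      + bregman_conj h gh (- u k.+1 - alpha k.+1 *: (z k.+1 - u k.+1))%R
          (- u k.+1)%R.
    have -> : (x k.+1 + alpha k.+1 *: (s k.+1 - x k.+1)
        = (1 - alpha k.+1) *: x k.+1 + alpha k.+1 *: s k.+1)%R.
      by rewrite scalerBl scale1r scalerBr addrAC addrA.
    rewrite HS //; congr (_ + bregman_conj h gh _ _).
    by rewrite scalerBl scale1r scalerBr !opprB addrA [(- _ + _)%R]addrC.
  move=> /le_trans; apply; rewrite HkE.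
  rewrite [X in _ <= X%:E](_ : _ = (1 - b) * Hk
    + C * b `^ gamma / gamma + Cstar * b `^ gamma / gamma)%R; last by ring.
  rewrite [leRHS]EFinD; apply: leeD; last exact: h_curv.
  by rewrite [leRHS]EFinD; apply: leeD; [rewrite EFinM|exact: f_curv].
split.
  by rewrite gapE HSE /= !lerD2r; apply: ler_wpM2l => //; rewrite subr_ge0.
(* This ratio is both the trial step and the base of the rate bounding [Hk], the form [rate_step]
   takes at [k.+1]. *)
pose b : R := (gamma / (k.+1%:R + gamma))%R.
have k0 : (0 <= k.+1%:R :> R)%R by [].
have b01 : (0 <= b <= 1)%R.
  by rewrite divr_ge0 ?ler_pdivrMr ?mul1r ?lerDr //; lra.
apply: le_trans (Hline _ b01) _.
have := rate_step gamma k.+1%:R gamma_gt1 k0; rewrite -/b.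
rewrite natr1 => /(ler_wpM2l C0); apply: le_trans.
rewrite mulrDr lerD2r mulrCA ler_wpM2l //; by case/andP: b01 => ? ?; lra.
Qed.
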